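(* Let $\mathbb{K}$ be a field, $n\ge 2$, and let $F=\{f_1,\dots,f_n\}\subset\mathbb{K}[x_1,\dots,x_n]$ be a cohesive set of $n$ monomials of degree two satisfying the canonical restrictions. Let $A_F$ denote the log matrix of $F$ and $G_F$ its graph. The following conditions are equivalent: (1) $\det A_F\neq 0$; (2) $F$ is a Cremona set; (3) either (i) $G_F$ has no loops and has a unique cycle, which is of odd length; or (ii) $G_F$ is a tree with exactly one loop.
   Context: For a set $F=\{f_1,\dots,f_n\}$ of $n$ monomials of the same degree $d$ in $\mathbb{K}[x_1,\dots,x_n]$, write $f_j=x_1^{v_{1j}}\cdots x_n^{v_{nj}}$. The log matrix is $A_F=(v_{ij})_{n\times n}$. $F$ is a Cremona set if the extension $\mathbb{K}[f_1,\dots,f_n]\subset \mathbb{K}[\underline{x}_d]$ becomes an equality on the level of fields of fractions, where $\mathbb{K}[\underline{x}_d]$ is the algebra generated by all monomials of degree $d$ in $x_1,\dots,x_n$ (equivalently, the rational map $\mathbb{P}^{n-1}\dashrightarrow\mathbb{P}^{n-1}$ given by $(f_1:\dots:f_n)$ is birational). Canonical restrictions: for each $j=1,\dots,n$ there is a $k$ with $x_j\mid f_k$ and there is a $k$ with $x_j\nmid f_k$. A set $F$ satisfying the canonical restrictions is cohesive if there is no partition $\underline{x}=\underline{y}\cup\underline{z}$ of the variables such that $F=G\cup H$ with $G$ and $H$ both nonempty, the forms in $G$ involving only the $\underline{y}$-variables and the forms in $H$ only the $\underline{z}$-variables. For $d=2$, the graph $G_F$ has vertex set $\{x_1,\dots,x_n\}$,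 an edge $\{x_i,x_j\}$ for each monomial $x_ix_j\in F$ with $i\ne j$, and a loop at $x_i$ for each monomial $x_i^2\in F$. A ''tree with exactly one loop'' means that $G_F$ has exactly one loop and becomes a tree when that loop is removed. *)

(* Defs.v *)
From HB Require Import structures.
From mathcomp Require Import all_boot all_order all_algebra.
From mathcomp Require Export mpoly.
Set Implicit Arguments.
Unset Strict Implicit.
Unset Printing Implicit Defensive.
Import GRing.Theory.
Local Open Scope ring_scope.

Definition is_monomial (K : fieldType) (n d : nat) (p : {mpoly K[n]}) : Prop :=
  exists2 m : 'X_{1..n}, mdeg m = d & p = 'X_[m].

(* Only used when all the f_j are monomials; mlead 'X_[m] is m, so that
   column j is then the exponent vector of f_j. The entries are integers
   (not elements of K): the determinant is taken in characteristic zero. *)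
Definition log_matrix (K : fieldType) (n : nat) (f : n.-tuple {mpoly K[n]}) :
    'M[int]_n :=
  \matrix_(i < n, j < n) (mlead (tnth f j) i)%:Z.

(* p lies in K[S], i.e. p = q(s_1, ..., s_k) with s_1, ..., s_k in S. *)
Definition in_subalgebra (K : fieldType) (n : nat)
    (S : {mpoly K[n]} -> Prop) (p : {mpoly K[n]}) : Prop :=
  exists (k : nat) (s : k.-tuple {mpoly K[n]}) (q : {mpoly K[k]}),
    (forall i, S (tnth s i)) /\ p = comp_mpoly s q.

(* The field of fractions of K[S], as a subfield of K(x_1, ..., x_n). *)
Definition in_subalgebra_fractions (K : fieldType) (n : nat)
    (S : {mpoly K[n]} -> Prop) (z : {fraction {mpoly K[n]}}) : Prop :=
  exists p q : {mpoly K[n]},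
    [/\ in_subalgebra S p, in_subalgebra S q, q != 0
      & z = tofrac p / tofrac q].

Definition cremona_set (K : fieldType) (n d : nat)
    (f : n.-tuple {mpoly K[n]}) : Prop :=
  forall z : {fraction {mpoly K[n]}},
    in_subalgebra_fractions (fun p => p \in f) z <->
    in_subalgebra_fractions (@is_monomial K n d) z.

Definition mpoly_dvd (K : fieldType) (n : nat) (p q : {mpoly K[n]}) : Prop :=
  exists r : {mpoly K[n]}, q = r * p.

Definition canonical_restrictions (K : fieldType) (n : nat)
    (f : n.-tuple {mpoly K[n]}) : Prop :=
  forall j : 'I_n,
    (exists k : 'I_n, mpoly_dvd 'X_j (tnth f k)) /\
    (exists k : 'I_n, ~ mpoly_dvd 'X_j (tnth f k)).

Definition involves_only (K : fieldType) (n : nat) (Y : {set 'I_n})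
    (p : {mpoly K[n]}) : Prop :=
  forall m : 'X_{1..n}, m \in msupp p -> forall i, i \notin Y -> m i = 0%N.

Definition cohesive (K : fieldType) (n : nat) (f : n.-tuple {mpoly K[n]}) :
    Prop :=
  ~ exists (Y Z : {set 'I_n}) (G H : seq {mpoly K[n]}),
      [/\ Y :|: Z = setT, Y :&: Z = set0,
          f =i G ++ H, G <> [::] /\ H <> [::]
        & (forall p, p \in G -> involves_only Y p) /\
          (forall p, p \in H -> involves_only Z p)].

(* The graph G_F on 'I_n: its edges between distinct vertices and its loops
   are kept apart, so graph_edge is G_F with the loops removed. *)
Definition graph_edge (K : fieldType) (n : nat) (f : n.-tuple {mpoly K[n]}) :
    rel 'I_n :=
  fun i j => (i != j) && ('X_i * 'X_j \in (f : seq {mpoly K[n]})).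

Definition graph_loop (K : fieldType) (n : nat) (f : n.-tuple {mpoly K[n]}) :
    pred 'I_n :=
  fun i => 'X_i ^+ 2 \in (f : seq {mpoly K[n]}).

Definition graph_cycle (T : finType) (e : rel T) (c : seq T) : Prop :=
  (2 < size c)%N /\ ucycle e c.

(* Two vertex sequences describe the same cycle (up to the starting point and
   the direction) when they have the same edges. *)
Definition cycle_edges (T : finType) (c : seq T) : {set {set T}} :=
  [set [set x; next c x] | x in c].

Definition has_unique_odd_cycle (T : finType) (e : rel T) : Prop :=
  exists c : seq T,
    [/\ graph_cycle e c,
        forall c', graph_cycle e c' -> cycle_edges c' = cycle_edges c
      & odd (size c)].

Definition is_tree (T : finType) (e : rel T) : Prop :=
  (forall x y, connect e x y) /\ (forall c, ~ graph_cycle e c).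

(* Main.v *)
(* Cohesiveness makes the graph connected. To a walk x = x_0, ..., x_k
   attach the alternating sum of its edges: the log matrix A sends it to
   e_x - (-1)^k e_(x_k). Modulo 2 this sum counts the traversals of each edge,
   so if the columns of A are independent, an even closed walk runs through
   every edge an even number of times. Hence every cycle is odd, two odd closed
   walks (loops included) use the same edges modulo 2, and there is at most one
   cycle or loop. There is an odd closed walk, since otherwise a 2-colouring of
   the vertices gives a vector killed by A on the left.
   Conversely, an odd closed walk in a connected graph yields walks of odd
   length between any two vertices, so every e_i + e_j is an integral
   combination of columns of A, and every x_i x_j is a quotient of products of
   the f_k. Finally, if F is a Cremona set, a weight vanishing on all the f_k
   vanishes on all the x_i^2, whence det A <> 0. *)
Require Import Defs.
From mathcomp Require Import all_boot all_order all_algebra mpoly.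
From mathcomp Require Import ring zify.
Set Implicit Arguments.
Unset Strict Implicit.
Unset Printing Implicit Defensive.
Import Order.TTheory GRing.Theory Num.Theory.
Local Open Scope ring_scope.

(** * Closed walks and cycles in finite graphs: edge counts and parity *)

Section ClosedWalks.

Variable T : finType.
Implicit Types (e : rel T) (x y : T) (p c : seq T) (s : {set T}).

Lemma eq_graph_cycle e (e' : rel T) c : e =2 e' ->
  graph_cycle e c <-> graph_cycle e' c.
Proof. by move=> eq_e; rewrite /graph_cycle /ucycle (eq_cycle eq_e). Qed.

(** A sequence, so that repeated traversals can be counted; a loop at [u] appears as a singleton. *)
Definition walk_edges x p : seq {set T} := pairmap (fun u v => [set u; v]) x p.

Lemma walk_edges_cat x p p' :
  walk_edges x (p ++ p') = walk_edges x p ++ walk_edges (last x p) p'.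
Proof. exact: pairmap_cat. Qed.

(** Edges are unordered, so walking back from [last x p] meets each of them equally often. *)
Lemma count_walk_edges_rev x p s :
  count_mem s (walk_edges (last x p) (rev (belast x p))) =
  count_mem s (walk_edges x p).
Proof.
elim: p x => [//|y p IHp] x.
rewrite /= rev_cons -cats1 walk_edges_cat count_cat IHp addnC /= addn0.
suff -> : last (last y p) (rev (belast y p)) = y by rewrite setUC.
by case: p {IHp} => //= z p; rewrite rev_cons last_rcons.
Qed.

Lemma last_rev_belast x p : last (last x p) (rev (belast x p)) = x.
Proof. by case: p => //= y p; rewrite rev_cons last_rcons. Qed.

Lemma rev_path_sym e x p : ssrbool.symmetric e ->
  path e (last x p) (rev (belast x p)) = path e x p.
Proof.
by move=> e_sym; rewrite rev_path; apply: eq_path => u v; rewrite e_sym.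
Qed.

Lemma walk_edges_cycle x p : uniq (x :: p) ->
  walk_edges x (rcons p x) = [seq [set y; next (x :: p) y] | y <- x :: p].
Proof.
move=> Up; apply: (@eq_from_nth _ set0).
  by rewrite size_pairmap size_rcons size_map.
move=> i; rewrite size_pairmap size_rcons => lt_i.
rewrite (nth_pairmap x) ?size_rcons // (nth_map x) //.
rewrite next_nth mem_nth // index_uniq // -rcons_cons nth_rcons lt_i.
congr [set _; _]; rewrite nth_rcons.
(* On the closing edge, [i = size p], both sides are [x], on the right as the default value of
   [nth]. *)
case: ltnP => // le_p; rewrite nth_default //.
by case: eqP.
Qed.

(** On a cycle of two vertices [next] would be an involution, which the length bound excludes. *)
Lemma next2_neq c x : (2 < size c)%N -> uniq c -> x \in c ->
  next c (next c x) != x.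
Proof.
move=> c_gt2 Uc c_x; have [i c' def_c] := rot_to c_x.
have Uc' : uniq (x :: c') by rewrite -def_c rot_uniq.
rewrite -(next_rot i Uc x) -(next_rot i Uc (next _ x)) def_c.
have : (2 < size (x :: c'))%N by rewrite -def_c size_rot.
case: c' Uc' {def_c} => [|y [|z c']] //= /and4P[].
rewrite !inE !negb_or => /and3P[x_y x_z _] /andP[y_z _] _ _ _.
by rewrite eqxx [y == x]eq_sym (negPf x_y) eqxx eq_sym.
Qed.

(** Distinct vertices with the same outgoing edge would be each other's successors, against
    [next2_neq]. *)
Lemma uniq_cycle_edges c : (2 < size c)%N -> uniq c ->
  uniq [seq [set y; next c y] | y <- c].
Proof.
move=> c_gt2 Uc; rewrite map_inj_in_uniq // => y z c_y c_z eq_yz.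
apply/eqP; apply: contraT => y'z.
have /set2P[/eqP|y_z] : y \in [set z; next c z] by rewrite -eq_yz set21.
  by rewrite (negPf y'z).
have /set2P[/eqP|z_y] : z \in [set y; next c y] by rewrite eq_yz set21.
  by rewrite eq_sym (negPf y'z).
by have /eqP := next2_neq c_gt2 Uc c_z; rewrite -y_z -z_y.
Qed.

(** A cycle traverses each of its edges exactly once, so the parity of the count decides membership
    in [cycle_edges]. *)
Lemma count_cycle_edges e x p s : graph_cycle e (x :: p) ->
  count_mem s (walk_edges x (rcons p x)) = (s \in cycle_edges (x :: p)) :> nat.
Proof.
case=> p_gt2 /andP[_ Up].
rewrite walk_edges_cycle // count_uniq_mem ?uniq_cycle_edges //.
by congr nat_of_bool; apply/mapP/imsetP=> -[y c_y ->]; exists y.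
Qed.

(* A shortest odd closed walk repeats no vertex: otherwise it splits there
   into two shorter closed walks, one of which is odd. *)
Lemma odd_closed_walk_cycle e x p : irreflexive e ->
  cycle e (x :: p) -> odd (size (x :: p)) ->
  exists c, graph_cycle e c /\ odd (size c).
Proof.
move=> e_irr; move: {2}_.+1 (ltnSn (size (x :: p))) => k.
elim: k x p => // k IHk x p le_k cyc_p odd_p.
have [Up | ] := boolP (uniq (x :: p)).
  exists (x :: p); split=> //; split; last by apply/andP.
  (* An odd length below three is one, which would be a loop. *)
  by case: p cyc_p odd_p {le_k Up} => [|y [|z p]] //=; rewrite e_irr.
move/(uniqPn x)=> [i [j [lt_ij lt_j eq_ij]]].
have lt_i := ltn_trans lt_ij lt_j.
set c := x :: p in le_k cyc_p odd_p lt_j lt_i eq_ij *.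
have [y [c1 [c2 [cyc_y sz_c]]]] : exists y c1 c2,
    cycle e (y :: c1 ++ y :: c2) /\ size c = size (y :: c1 ++ y :: c2).
  (* Rotating by [i] brings the repeated vertex to the front; it recurs at [j - i]. *)
  pose d := rot i c; have size_d : size d = size c by rewrite size_rot.
  have nth_d k' : (i + k' < size c)%N -> nth x d k' = nth x c (i + k').
    move=> lt_k'; rewrite /d /rot nth_cat size_drop ltn_subRL lt_k'.
    by rewrite nth_drop.
  have : cycle e d by rewrite rot_cycle.
  have d_j : nth x d (j - i) = nth x d 0.
    by rewrite !nth_d ?addn0 ?subnKC // ltnW.
  have lt_d : (j - i < size d)%N
    by rewrite size_d (leq_ltn_trans (leq_subr _ _)).
  have lt_0 : (0 < j - i)%N by rewrite subn_gt0.
  case def_d: d lt_d d_j size_d => [|y d'] //.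
  case: (j - i)%N lt_0 => [|j'] //= _ lt_d d_j size_d cyc_d.
  exists y, (take j' d'), (drop j'.+1 d').
  have -> : take j' d' ++ y :: drop j'.+1 d' = d'.
    by rewrite -d_j -drop_nth // cat_take_drop.
  by rewrite size_d.
have [cyc1 cyc2] : cycle e (y :: c1) /\ cycle e (y :: c2).
  move: cyc_y; rewrite /= rcons_cat cat_path /= !rcons_path.
  by case/and4P=> -> -> -> ->.
move: odd_p le_k; rewrite sz_c /= size_cat /= => odd_c le_k.
have [odd1 | even1] := boolP (odd (size (y :: c1))).
  by apply: IHk cyc1 odd1; rewrite /=; lia.
by apply: IHk cyc2 _; move: even1; rewrite /=; lia.
Qed.

(* Connectivity of the bipartite double cover of e: [true] means "odd". *)
Definition odd_step e : rel (T * bool) :=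
  fun u v => e u.1 v.1 && (u.2 != v.2).

Lemma odd_step_path e u v : connect (odd_step e) u v ->
  exists p, [/\ path e u.1 p, last u.1 p = v.1 & odd (size p) = u.2 (+) v.2].
Proof.
case/connectP=> p; elim: p u => [|w p IHp] u /=.
  by move=> _ ->; exists [::]; rewrite addbb.
rewrite {1}/odd_step -andbA => /and3P[e_uw ne_uw w_p] def_v.
have [q [e_q last_q odd_q]] := IHp _ w_p def_v.
exists (w.1 :: q); rewrite /= e_uw e_q odd_q; split=> //.
by move: ne_uw; case: (u.2) (w.2) (v.2) => [] [] [].
Qed.

Lemma path_odd_step e x b p : path e x p ->
  connect (odd_step e) (x, b) (last x p, b (+) odd (size p)).
Proof.
elim: p x b => [|y p IHp] x b /=; first by rewrite addbF.
case/andP=> e_xy /(IHp y (~~ b)); rewrite addNb -addbN.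
apply: connect_trans; apply: connect1.
by rewrite /odd_step e_xy; case: b.
Qed.

End ClosedWalks.

Lemma set2_eqP (T : finType) (x y u v : T) :
  reflect (x = u /\ y = v \/ x = v /\ y = u) ([set x; y] == [set u; v]).
Proof.
apply: (iffP eqP) => [eq_xy|[] [-> ->] //]; last by rewrite setUC.
have /set2P x_uv : x \in [set u; v] by rewrite -eq_xy set21.
have /set2P y_uv : y \in [set u; v] by rewrite -eq_xy set22.
have /set2P u_xy : u \in [set x; y] by rewrite eq_xy set21.
have /set2P v_xy : v \in [set x; y] by rewrite eq_xy set22.
by intuition congruence.
Qed.

(** * The unsigned incidence matrix and the alternating vectors of walks *)

Section IncidenceMatrix.

Variables (n m : nat) (a b : 'I_m -> 'I_n).

Let ends k : {set 'I_n} := [set a k; b k].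

(** A loop, [a k = b k], gets the entry 2, the exponent in a square. *)
Definition incidence_mx : 'M[int]_(n, m) :=
  \matrix_(i, k) ((i == a k) + (i == b k))%N%:R.

Definition adjacent : rel 'I_n :=
  fun i j => [exists k, [set a k; b k] == [set i; j]].

Definition proper_adjacent : rel 'I_n :=
  fun i j => (i != j) && adjacent i j.

Let vx i : 'cV[int]_n := delta_mx i 0.

(* The signs alternate, so that the image under incidence_mx telescopes. *)
Fixpoint walk_vec (x : 'I_n) (p : seq 'I_n) : 'cV[int]_m :=
  if p is y :: q then \col_k ([set a k; b k] == [set x; y])%:R - walk_vec y q
  else 0.

Lemma adjacent_sym : ssrbool.symmetric adjacent.
Proof. by move=> i j; rewrite /adjacent setUC. Qed.

Lemma mulmx_incidence (u : 'rV[int]_n) k :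
  (u *m incidence_mx) 0 k = u 0 (a k) + u 0 (b k).
Proof.
rewrite !mxE; under eq_bigr => i _ do rewrite mxE natrD mulrDr.
rewrite big_split /=; congr (_ + _).
  rewrite (bigD1 (a k)) //= eqxx mulr1 big1 ?addr0 // => i /negPf->.
  by rewrite mulr0n mulr0.
rewrite (bigD1 (b k)) //= eqxx mulr1 big1 ?addr0 // => i /negPf->.
by rewrite mulr0n mulr0.
Qed.

Hypothesis ends_inj : injective ends.

(** Distinct edges have distinct end sets, so the indicator is a unit vector and picks out a single
    column. *)
Lemma incidence_edge i j : adjacent i j ->
  incidence_mx *m (\col_k ([set a k; b k] == [set i; j])%:R) = vx i + vx j.
Proof.
case/existsP=> k /eqP def_ij; apply/colP=> x; rewrite !mxE.
rewrite (bigD1 k) //= big1 ?addr0 => [|l l'k]; last first.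
  rewrite !mxE; case: ([set a l; b l] =P _) => [eq_l|_]; last by rewrite mulr0.
  by case/eqP: l'k; apply: ends_inj; rewrite /ends eq_l.
rewrite !mxE def_ij eqxx mulr1 !andbT -natrD; congr (_ %:R).
by case/eqP/set2_eqP: def_ij => -[-> ->] //; rewrite addnC.
Qed.

Lemma mul_walk_vec x p : path adjacent x p ->
  incidence_mx *m walk_vec x p = vx x - (-1) ^+ size p *: vx (last x p).
Proof.
elim: p x => [|y p IHp] x /=.
  by rewrite mulmx0 expr0 scale1r subrr.
case/andP=> xy /IHp{}IHp; rewrite mulmxBr IHp incidence_edge //.
by rewrite exprS mulN1r scaleNr opprK opprB addrACA subrr addr0.
Qed.

(** Modulo 2 the alternating signs disappear; [z + z] is the even defect they leave. *)
Lemma walk_vec_parity x p k : exists z : int,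
  walk_vec x p k 0 =
  (count_mem [set a k; b k] (walk_edges x p))%:R + z + z.
Proof.
elim: p x => [|y p IHp] x /=; first by exists 0; rewrite mxE !addr0.
have [z def_z] := IHp y; rewrite !mxE def_z eq_sym.
(* With [c] the count along [p], [- (c + z + z)] is [c] plus twice this witness. *)
exists (- z - (count_mem [set a k; b k] (walk_edges y p))%:R).
rewrite natrD /walk_edges.
by set u : int := _%:R; set v : int := _%:R; lia.
Qed.

Lemma walk_edges_adjacent x p s : path adjacent x p ->
  s \in walk_edges x p -> exists k, s = [set a k; b k].
Proof.
elim: p x => [|y p IHp] x //= /andP[/existsP[k /eqP def_k] y_p].
rewrite inE => /orP[/eqP-> | /(IHp y y_p) //]; by exists k.
Qed.

(* Through the odd closed walk, any two vertices are joined by walks of both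
   parities. *)
Lemma odd_closed_walk_lattice x p :
  (forall i j, connect adjacent i j) ->
  path adjacent x p -> last x p = x -> odd (size p) ->
  forall i j, exists c : 'cV[int]_m, incidence_mx *m c = vx i + vx j.
Proof.
move=> adj_conn x_p last_p odd_p i j.
suff [q [i_q last_q odd_q]] :
    exists q, [/\ path adjacent i q, last i q = j & odd (size q)].
  exists (walk_vec i q); rewrite mul_walk_vec // last_q -signr_odd odd_q.
  by rewrite expr1 scaleN1r opprK.
have [/connectP[q1 i_q1 last_q1] /connectP[q2 x_q2 last_q2]] :=
  (adj_conn i x, adj_conn x j).
have [odd12 | even12] := boolP (odd (size (q1 ++ q2))).
  by exists (q1 ++ q2); rewrite cat_path last_cat -last_q1 i_q1.
exists (q1 ++ p ++ q2); rewrite !cat_path !last_cat -last_q1 last_p i_q1 x_p.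
split=> //; move: even12; rewrite !size_cat !oddD odd_p.
by case: (odd _) (odd _) => [] [].
Qed.

Section Connected.

Hypothesis adj_conn : forall i j, connect adjacent i j.

(* Otherwise the graph is bipartite, and the sign vector of a 2-colouring
   vanishes on all the columns. *)
Lemma exists_odd_closed_walk (x : 'I_n) :
  (forall u : 'rV[int]_n, u *m incidence_mx = 0 -> u = 0) ->
  exists p, [/\ path adjacent x p, last x p = x & odd (size p)].
Proof.
move=> lker0.
have [/odd_step_path[p /= p_odd] | even_x] :=
  boolP (connect (odd_step adjacent) (x, false) (x, true)); first by exists p.
pose even_at i := connect (odd_step adjacent) (x, false) (i, false).
pose odd_at i := connect (odd_step adjacent) (x, false) (i, true).
have step i j : adjacent i j ->
    (even_at i -> odd_at j) /\ (odd_at i -> even_at j).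
  by move=> ij; split=> /connect_trans; apply; apply: connect1;
    rewrite /odd_step /= ij.
have even_or_odd i : even_at i || odd_at i.
  have /connectP[p x_p last_p] := adj_conn x i.
  have := path_odd_step false x_p; rewrite -last_p addFb.
  by rewrite /even_at /odd_at; case: (odd _) => ->; rewrite ?orbT.
(* An odd walk to [i] followed by the reverse of an even one would be an odd closed walk at [x]. *)
have even_nodd i : even_at i -> odd_at i -> False.
  move=> /odd_step_path[p [/= x_p last_p even_p]].
  move=> /odd_step_path[q [/= x_q last_q odd_q]].
  case/negP: even_x.
  have := @path_odd_step _ adjacent x false (q ++ rev (belast x p)).
  rewrite cat_path x_q last_cat last_q -last_p rev_path_sym; last first.
    exact: adjacent_sym.
  rewrite last_rev_belast size_cat size_rev size_belast oddD odd_q even_p.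
  exact.
pose u : 'rV[int]_n := \row_i (if even_at i then 1 else -1).
have: u = 0.
  apply: lker0; apply/rowP=> k; rewrite mulmx_incidence !mxE.
  have ab : adjacent (a k) (b k) by apply/existsP; exists k.
  have ba : adjacent (b k) (a k) by rewrite adjacent_sym.
  case: ifP (even_or_odd (a k)) => [even_a _ | _ /= odd_a].
    case: ifP => // even_b; case: (even_nodd (b k)) => //.
    exact: (step _ _ ab).1.
  by rewrite ((step _ _ ab).2 odd_a).
by move/rowP/(_ x); rewrite !mxE /even_at connect0.
Qed.

Hypothesis rker0 : forall c : 'cV[int]_m, incidence_mx *m c = 0 -> c = 0.

(** The image of its vector telescopes to [vx x - vx x], so the vector is 0 and [walk_vec_parity]
    makes each edge count even. *)
Lemma even_closed_walk x p s : path adjacent x p -> last x p = x ->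
  ~~ odd (size p) -> ~~ odd (count_mem s (walk_edges x p)).
Proof.
move=> x_p last_p even_p.
have [/(walk_edges_adjacent x_p)[k ->] | /count_memPn->//] :=
  boolP (s \in walk_edges x p).
have: walk_vec x p = 0.
  apply: rker0; rewrite mul_walk_vec // last_p -signr_odd (negPf even_p).
  by rewrite expr0 scale1r subrr.
move/colP/(_ k); have [z ->] := walk_vec_parity x p k.
rewrite mxE; set c := count_mem _ _; move: c => c.
lia.
Qed.

(* Join the two walks by a path traversed back and forth. *)
Lemma odd_closed_walks_same_edges x p y q s :
  path adjacent x p -> last x p = x -> odd (size p) ->
  path adjacent y q -> last y q = y -> odd (size q) ->
  odd (count_mem s (walk_edges x p)) = odd (count_mem s (walk_edges y q)).
Proof.
move=> x_p last_p odd_p y_q last_q odd_q.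
have /connectP[r x_r last_r] := adj_conn x y.
have := @even_closed_walk x (p ++ r ++ q ++ rev (belast x r)) s.
rewrite !cat_path !last_cat last_p -last_r last_q last_r.
rewrite rev_path_sym; last first.
  exact: adjacent_sym.
rewrite -last_r x_p x_r y_q last_r last_rev_belast.
rewrite !size_cat size_rev size_belast !oddD odd_p odd_q => /(_ isT erefl).
rewrite !walk_edges_cat last_p -last_r last_q !count_cat last_r.
rewrite count_walk_edges_rev !oddD.
by do 4!case: (odd _) => //=; move=> /(_ isT).
Qed.

Lemma proper_cycle_walk x p : graph_cycle proper_adjacent (x :: p) ->
  path adjacent x (rcons p x) /\ last x (rcons p x) = x.
Proof.
case=> _ /andP[x_p _]; rewrite last_rcons; split=> //.
by apply: sub_path x_p => i j /andP[].
Qed.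

(** An even cycle would traverse each of its edges once, against [even_closed_walk]. *)
Lemma proper_cycle_odd c : graph_cycle proper_adjacent c -> odd (size c).
Proof.
case: c => [[]//|x p] c_cyc; apply: contraT => even_c.
have [x_p last_p] := proper_cycle_walk c_cyc.
have := even_closed_walk [set x; next (x :: p) x] x_p last_p.
rewrite size_rcons (count_cycle_edges _ c_cyc) => /(_ even_c).
by rewrite (imset_f (fun y => [set y; next (x :: p) y])) ?mem_head.
Qed.

Lemma loop_walk i : adjacent i i ->
  [/\ path adjacent i [:: i], last i [:: i] = i & odd (size [:: i])].
Proof. by move=> ii; rewrite /= ii. Qed.

(** Both cycles are odd closed walks, so their edge counts agree modulo 2; being 0 or 1, they
    agree. *)
Lemma proper_cycle_edges_unique c c' :
  graph_cycle proper_adjacent c -> graph_cycle proper_adjacent c' ->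
  cycle_edges c' = cycle_edges c.
Proof.
move=> c_cyc c'_cyc; apply/setP=> s.
have [odd_c odd_c'] := (proper_cycle_odd c_cyc, proper_cycle_odd c'_cyc).
case: c c_cyc odd_c => [[]//|x p] c_cyc odd_c.
case: c' c'_cyc odd_c' => [[]//|y q] c'_cyc odd_c'.
have [[x_p last_p] [y_q last_q]] :=
  (proper_cycle_walk c_cyc, proper_cycle_walk c'_cyc).
have := odd_closed_walks_same_edges s y_q last_q _ x_p last_p _.
rewrite !size_rcons (count_cycle_edges _ c_cyc) (count_cycle_edges _ c'_cyc).
by rewrite !oddb; apply.
Qed.

Lemma loop_unique i j : adjacent i i -> adjacent j j -> i = j.
Proof.
move=> /loop_walk[i_i last_i odd_i] /loop_walk[j_j last_j odd_j].
have := odd_closed_walks_same_edges [set i] i_i last_i odd_i j_j last_j odd_j.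
by rewrite /= !setUid eqxx addn0; case: eqP => // /set1_inj.
Qed.

(** The loop is an odd closed walk, so its edge [[set i]] would lie on the cycle, whose consecutive
    vertices are distinct. *)
Lemma loop_no_cycle i c :
  adjacent i i -> ~ graph_cycle proper_adjacent c.
Proof.
move=> /loop_walk[i_i last_i odd_i] c_cyc.
have odd_c := proper_cycle_odd c_cyc.
case: c c_cyc odd_c => [[]//|x p] c_cyc odd_c.
have [x_p last_p] := proper_cycle_walk c_cyc.
have := odd_closed_walks_same_edges [set i] i_i last_i odd_i x_p last_p.
rewrite size_rcons => /(_ odd_c); rewrite (count_cycle_edges _ c_cyc).
rewrite /= setUid eqxx oddb => /esym/imsetP[y c_y] eq_i.
have [_ /andP[cyc_c _]] := c_cyc.
have /andP[/eqP[]] := next_cycle cyc_c c_y.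
have /set1P y_i : y \in [set i] by rewrite eq_i set21.
have /set1P : next (x :: p) y \in [set i] by rewrite eq_i set22.
by rewrite y_i => ->.
Qed.

End Connected.

End IncidenceMatrix.

(** * Subalgebras generated by monomials, their fractions, and weights *)

Section MonomialSubalgebra.

Variables (K : fieldType) (n l : nat) (f : l.-tuple {mpoly K[n]}).

(** The list [s] may repeat or omit entries of [f]; renaming variables along an index map [g]
    absorbs this. *)
Lemma in_subalgebra_tupleP (p : {mpoly K[n]}) :
  in_subalgebra (fun q => q \in f) p <-> exists q, p = q \mPo f.
Proof.
split=> [[k [s [q [s_f ->]]]] | [q ->]]; last first.
  by exists l, f, q; split=> // i; apply: mem_tnth.
have /fin_all_exists[g s_g] i : exists j, tnth s i = tnth f j.
  by have /tnthP[j] := s_f i; exists j.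
exists (q \mPo [tuple 'X_(g i) | i < k]).
rewrite [q \mPo [tuple _ | _ < _]]comp_mpolyEX comp_mpolyEX raddf_sum /=.
apply: eq_bigr => m _; rewrite comp_mpolyZ; congr (_ *: _).
rewrite !comp_mpolyX rmorph_prod; apply: eq_bigr => i _ /=.
by rewrite rmorphXn /= tnth_mktuple comp_mpolyXU -tnth_nth s_g.
Qed.

(* Membership in the field of fractions of K[f], without the denominators. *)
Definition rational_in (p : {mpoly K[n]}) : Prop :=
  exists q r, q \mPo f != 0 /\ p * (q \mPo f) = r \mPo f.

Lemma rational_inC c : rational_in c%:MP.
Proof.
exists 1, c%:MP; split; first by rewrite comp_mpoly1 oner_neq0.
by rewrite comp_mpoly1 mulr1 comp_mpolyC.
Qed.

Lemma rational_inM p1 p2 :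
  rational_in p1 -> rational_in p2 -> rational_in (p1 * p2).
Proof.
move=> [q1 [r1 [nz1 def1]]] [q2 [r2 [nz2 def2]]].
exists (q1 * q2), (r1 * r2); split; first by rewrite rmorphM mulf_neq0.
by rewrite !rmorphM /= -def1 -def2 mulrACA.
Qed.

Lemma rational_inD p1 p2 :
  rational_in p1 -> rational_in p2 -> rational_in (p1 + p2).
Proof.
move=> [q1 [r1 [nz1 def1]]] [q2 [r2 [nz2 def2]]].
exists (q1 * q2), (r1 * q2 + r2 * q1); split.
  by rewrite rmorphM mulf_neq0.
by rewrite rmorphM rmorphD !rmorphM /= -def1 -def2; ring.
Qed.

Lemma rational_in_comp k (s : k.-tuple {mpoly K[n]}) (q : {mpoly K[k]}) :
  (forall i, rational_in (tnth s i)) -> rational_in (q \mPo s).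
Proof.
move=> s_rat; rewrite comp_mpolyE.
have rat0 : rational_in 0 by rewrite -mpolyC0; apply: rational_inC.
have rat1 : rational_in 1 by rewrite -mpolyC1; apply: rational_inC.
apply: big_ind => // [|m _]; first exact: rational_inD.
rewrite -mul_mpolyC; apply: rational_inM; first exact: rational_inC.
apply: big_ind => // [|i _]; first exact: rational_inM.
by elim: (m i) => [|d IHd]; rewrite ?expr0 // exprS; apply: rational_inM.
Qed.

Variable mk : 'I_l -> 'X_{1..n}.
Hypothesis f_mk : forall k, tnth f k = 'X_[mk k].

Let A : 'M[int]_(n, l) := \matrix_(i, k) (mk k i)%:Z.

Lemma comp_monomials (e : 'X_{1..l}) :
  'X_[e] \mPo f = 'X_[(\sum_k (mk k *+ e k))%MM].
Proof.
by rewrite comp_mpolyX -mprodXnE; apply: eq_bigr => k _; rewrite f_mk.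
Qed.

Lemma comp_monomials_exp (e : 'X_{1..l}) i :
  ((\sum_k (mk k *+ e k))%MM i)%:Z = \sum_k A i k * (e k)%:Z.
Proof.
rewrite mnm_sumE -natz natr_sum; apply: eq_bigr => k _.
by rewrite mulmnE natrM !natz mxE.
Qed.

(** The monomial is a Laurent monomial in the [f_k]: the positive part of [c] gives the numerator
    [e1], the negative part the denominator [e2]. *)
Lemma monomial_rational_in (c : 'cV[int]_l) (m : 'X_{1..n}) :
  A *m c = \col_i (m i)%:Z -> rational_in 'X_[m].
Proof.
move=> def_m.
pose pos_part (z : int) := if z is Posz d then d else 0%N.
pose e1 := [multinom pos_part (c k 0)%R | k < l].
pose e2 := [multinom pos_part (- c k 0)%R | k < l].
exists 'X_[e2], 'X_[e1]; rewrite !comp_monomials; split.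
  by rewrite -msupp_eq0 msuppX.
rewrite -mpolyXD; congr ('X_[_]); apply/mnmP=> i; apply: (can_inj absz_nat).
rewrite mnmDE PoszD !comp_monomials_exp.
have /colP/(_ i) := def_m; rewrite !mxE => <-.
rewrite -big_split; apply: eq_bigr => k _ /=; rewrite -mulrDr; congr (_ * _).
rewrite !mnmE; case: (c k 0) => d; first by case: d => /= *; rewrite ?addr0.
by rewrite /= NegzE addNr.
Qed.

(** Each [f_k] has weight 0 under [u], hence so do their products; every monomial of [q \mPo f] is
    such a product. *)
Lemma comp_monomials_weight (u : 'rV[int]_n) q m : u *m A = 0 ->
  m \in msupp (q \mPo f) -> \sum_i u 0 i * (m i)%:Z = 0.
Proof.
move=> uA0; rewrite comp_mpolyEX => m_q.
have /hasP[e _ /eqP->] :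
    has (fun e : 'X_{1..l} => m == (\sum_k (mk k *+ e k))%MM) (msupp q).
  apply: contraLR m_q => /hasPn no_e; rewrite -mcoeff_eq0 raddf_sum.
  rewrite big_seq big1 // => e /no_e m'e.
  by rewrite comp_monomials /= mcoeffZ mcoeffX eq_sym (negPf m'e) mulr0.
rewrite (eq_bigr (fun i : 'I_n => \sum_k u 0 i * (A i k * (e k)%:Z)));
  last first.
  by move=> i _; rewrite -mulr_sumr -comp_monomials_exp.
rewrite exchange_big /= big1 // => k _.
under eq_bigr => i _ do rewrite mulrA.
rewrite -mulr_suml; have /rowP/(_ k) := uA0; rewrite !mxE => ->.
by rewrite mul0r.
Qed.

(** If [m'] occurs in the denominator, [m + m'] occurs in the numerator; both have weight 0. *)
Lemma rational_in_weight (u : 'rV[int]_n) m : u *m A = 0 ->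
  rational_in 'X_[m] -> \sum_i u 0 i * (m i)%:Z = 0.
Proof.
move=> uA0 [q [r [nz_q def_r]]].
have q_m' := mlead_supp nz_q; set m' := mlead _ in q_m'.
have r_mm' : (m + m')%MM \in msupp (r \mPo f).
  by rewrite -def_r mulrC mcoeff_msupp mcoeffMX -mcoeff_msupp.
have := comp_monomials_weight uA0 r_mm'.
under eq_bigr => i _ do rewrite mnmDE PoszD mulrDr.
by rewrite big_split /= (comp_monomials_weight uA0 q_m') addr0.
Qed.

End MonomialSubalgebra.

(** * Cremona sets tested on monomials *)

Section CremonaSet.

Variables (K : fieldType) (n d : nat) (f : n.-tuple {mpoly K[n]}).

Lemma in_subalgebra_gen (S : {mpoly K[n]} -> Prop) p :
  S p -> in_subalgebra S p.
Proof.
move=> Sp; exists 1%N, [tuple p], 'X_ord0; split=> [i|].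
  by rewrite ord1.
by rewrite comp_mpolyXU.
Qed.

Lemma in_subalgebra1 (S : {mpoly K[n]} -> Prop) : in_subalgebra S 1.
Proof. by exists 0%N, [tuple], 1; split=> [[]|] //; rewrite comp_mpoly1. Qed.

(** One inclusion of fields holds because the [f_k] are themselves monomials of degree [d]; the
    other need only be tested on generators. *)
Lemma cremona_setP : (forall k, is_monomial d (tnth f k)) ->
  cremona_set d f <-> (forall p, is_monomial d p -> rational_in f p).
Proof.
move=> f_mono; split=> [f_crem p p_mono | f_rat z].
  have /f_crem : in_subalgebra_fractions (@is_monomial K n d) (tofrac p).
    exists p, 1; split; last by rewrite tofrac1 divr1.
    - exact: in_subalgebra_gen.
    - exact: in_subalgebra1.
    exact: oner_neq0.
  case=> _ [_ [/in_subalgebra_tupleP[r ->] /in_subalgebra_tupleP[q ->] nz_q]].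
  move=> def_p; have /eqP : tofrac (p * (q \mPo f)) = tofrac (r \mPo f).
    by rewrite tofracM def_p divfK ?tofrac_eq0.
  rewrite tofrac_eq => /eqP def_r.
  by exists q, r.
split=> -[p [q [p_in q_in nz_q ->]]].
  exists p, q; split=> //.
    case: p_in => k [s [r [s_f ->]]]; exists k, s, r; split=> // i.
    by have /tnthP[j ->] := s_f i.
  case: q_in => k [s [r [s_f ->]]]; exists k, s, r; split=> // i.
  by have /tnthP[j ->] := s_f i.
have rat r : in_subalgebra (@is_monomial K n d) r -> rational_in f r.
  by case=> k [s [r' [s_mono ->]]]; apply: rational_in_comp => i; apply: f_rat.
have [[q1 [r1 [nz1 def1]]] [q2 [r2 [nz2 def2]]]] := (rat p p_in, rat q q_in).
have nz_r2 : r2 \mPo f != 0 by rewrite -def2 mulf_neq0.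
(* After substituting [f], [p = r1 / q1] and [q = r2 / q2]. *)
exists ((r1 * q2) \mPo f), ((r2 * q1) \mPo f); split.
- by apply/in_subalgebra_tupleP; exists (r1 * q2).
- by apply/in_subalgebra_tupleP; exists (r2 * q1).
- by rewrite rmorphM mulf_neq0.
apply/eqP; rewrite eqr_div ?tofrac_eq0 ?rmorphM ?mulf_neq0 //=.
by rewrite -!tofracM tofrac_eq -def1 -def2; apply/eqP; ring.
Qed.

End CremonaSet.

(** * Quadratic monomials as unordered pairs of variables *)

Section QuadraticMonomials.

Variable n : nat.

Lemma mdeg2P (m : 'X_{1..n}) :
  mdeg m = 2%N -> exists i j, m = (U_(i) + U_(j))%MM.
Proof.
move=> m2; have [i m_i] : exists i, m i != 0%N.
  apply/existsP; apply: contraT; rewrite negb_exists => /forallP m0.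
  move: m2; rewrite mdegE big1 // => i _; apply/eqP.
  by have := m0 i; rewrite negbK.
rewrite -lep1mP in m_i; move: m2; rewrite -(submK m_i) mdegD mdeg1 addn1.
by case=> /eqP/mdeg1P[j /eqP->]; exists j, i.
Qed.

Lemma mnm1D_neq0 (i j x : 'I_n) :
  ((U_(i) + U_(j))%MM x != 0%N) = (x \in [set i; j]).
Proof.
by rewrite mnmDE !mnm1E addn_eq0 !eqb0 negb_and !negbK !inE !(eq_sym x).
Qed.

(** A quadratic monomial is determined by its support, a singleton for a square. *)
Lemma mnm1D_eq (i j x y : 'I_n) :
  (U_(i) + U_(j) == U_(x) + U_(y))%MM = ([set i; j] == [set x; y]).
Proof.
apply/eqP/set2_eqP => [eq_ij | [] [-> ->] //]; last by rewrite addmC.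
by apply/set2_eqP/eqP/setP=> z; rewrite -!mnm1D_neq0 eq_ij.
Qed.

Variable K : fieldType.

Lemma mpolyX2_eq (i j x y : 'I_n) :
  ('X_i * 'X_j == 'X_x * 'X_y :> {mpoly K[n]}) = ([set i; j] == [set x; y]).
Proof.
rewrite -!mpolyXD -mnm1D_eq; apply/eqP/eqP => [eq_X | -> //].
by rewrite -(mleadXm K (U_(i) + U_(j))) eq_X mleadXm.
Qed.

Lemma mpoly_dvd_XX (i j x : 'I_n) :
  mpoly_dvd 'X_x ('X_i * 'X_j : {mpoly K[n]}) -> x \in [set i; j].
Proof.
case=> r def_r; apply: contraT; rewrite !inE negb_or => /andP[x'i x'j].
(* Evaluate at the point whose [x]-coordinate is 0 and whose other coordinates are 1. *)
have /eqP := congr1 (meval (fun y => (y != x)%:R)) def_r.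
rewrite !mevalM !mevalXU eqxx mulr0 ![_ == x]eq_sym x'i x'j mulr1.
by rewrite oner_eq0.
Qed.

Lemma involves_only_XX (Y : {set 'I_n}) (i j : 'I_n) :
  i \in Y -> j \in Y -> involves_only Y ('X_i * 'X_j : {mpoly K[n]}).
Proof.
move=> Yi Yj m; rewrite -mpolyXD msuppX inE => /eqP-> x Y'x.
apply/eqP; rewrite -[_ == _]negbK mnm1D_neq0; apply: contra Y'x.
by case/set2P=> ->.
Qed.

End QuadraticMonomials.

(** * The graph of a set of quadratic monomials, and its connectedness *)

Section GraphOfMonomials.

Variables (K : fieldType) (n : nat) (f : n.-tuple {mpoly K[n]}).
Variables a b : 'I_n -> 'I_n.
Hypothesis f_ab : forall k, tnth f k = 'X_(a k) * 'X_(b k).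

Lemma adjacentE i j : adjacent a b i j = ('X_i * 'X_j \in (f : seq _)).
Proof.
apply/existsP/tnthP=> -[k].
  by move=> ab_ij; exists k; apply/eqP; rewrite f_ab eq_sym mpolyX2_eq.
by move/eqP; rewrite f_ab mpolyX2_eq eq_sym => ab_ij; exists k.
Qed.

Lemma graph_edgeE : graph_edge f =2 proper_adjacent a b.
Proof. by move=> i j; rewrite /proper_adjacent adjacentE. Qed.

Lemma graph_loopE i : graph_loop f i = adjacent a b i i.
Proof. by rewrite adjacentE -expr2. Qed.

Lemma log_matrixE : log_matrix f = incidence_mx a b.
Proof.
apply/matrixP=> i k; rewrite !mxE f_ab -mpolyXD mleadXm mnmDE !mnm1E natz.
by rewrite ![_ == i]eq_sym.
Qed.

Lemma ends_injective : uniq f -> injective (fun k => [set a k; b k]).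
Proof.
move=> /tuple_uniqP tnth_inj k l /eqP.
by rewrite -(mpolyX2_eq K) -!f_ab => /eqP/tnth_inj.
Qed.

(** Otherwise the component [Y] of [x] and its complement split the monomials; both parts are
    nonempty since [x] and [y] each divide some [f_k]. *)
Lemma cohesive_connected : canonical_restrictions f -> cohesive f ->
  forall x y, connect (adjacent a b) x y.
Proof.
move=> f_can f_coh x y; apply: contraT => not_xy; case: f_coh.
pose Y := [set z | connect (adjacent a b) x z].
have Yab k : (a k \in Y) = (b k \in Y).
  have ab : adjacent a b (a k) (b k) by apply/existsP; exists k.
  rewrite !inE; apply/idP/idP=> /connect_trans; apply; apply: connect1 => //.
  by rewrite adjacent_sym.
have in_f z : exists2 k, tnth f k \in f & z \in [set a k; b k].
  have [[k dvd_z] _] := f_can z; exists k; first exact: mem_tnth.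
  by apply: (@mpoly_dvd_XX n K); rewrite -f_ab.
exists Y, (~: Y), [seq tnth f k | k <- enum 'I_n & a k \in Y],
  [seq tnth f k | k <- enum 'I_n & a k \notin Y].
split; [exact: setUCr | exact: setICr | | |].
- move=> p; rewrite mem_cat; apply/tnthP/orP=> [[k ->]|].
    have [Ya | Y'a] := boolP (a k \in Y); [left | right];
      by apply/map_f; rewrite mem_filter ?Ya ?Y'a mem_enum.
  by case=> /mapP[k _ ->]; exists k.
- have nonempty (P : pred 'I_n) k : P k ->
    [seq tnth f k | k <- enum 'I_n & P k] <> [::].
    move=> Pk empty; suff: tnth f k \in [::] by [].
    by rewrite -empty map_f // mem_filter Pk mem_enum.
  have [[k _ kx] [l _ ly]] := (in_f x, in_f y).
  have Yx : x \in Y by rewrite inE connect0.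
  have Y'y : y \notin Y by rewrite inE.
  split.
    apply: (nonempty (fun k => a k \in Y) k).
    by case/set2P: kx Yx => ->; rewrite ?Yab.
  apply: (nonempty (fun k => a k \notin Y) l).
  by case/set2P: ly Y'y => ->; rewrite ?Yab.
split=> p /mapP[k]; rewrite mem_filter => /andP[Yk _] ->; rewrite f_ab;
  by apply: involves_only_XX; rewrite ?in_setC -?Yab.
Qed.

End GraphOfMonomials.

(** * The equivalences, by a circle of three implications *)

Theorem proposition3p8 (K : fieldType) (n : nat) (hn : (2 <= n)%N)
    (f : n.-tuple {mpoly K[n]})
    (f_uniq : uniq f)
    (f_monomial : forall j : 'I_n, is_monomial 2 (tnth f j))
    (f_canonical : canonical_restrictions f)
    (f_cohesive : cohesive f) :
  (\det (log_matrix f) != 0 <-> cremona_set 2 f) /\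
  (cremona_set 2 f <->
     ((forall i : 'I_n, ~~ graph_loop f i) /\
        has_unique_odd_cycle (graph_edge f)) \/
     (is_tree (graph_edge f) /\
        (exists! i : 'I_n, graph_loop f i))).
Proof.
have /fin_all_exists[a /fin_all_exists[b f_ab]] (k : 'I_n) :
    exists i j, tnth f k = 'X_i * 'X_j.
  have [m m2 ->] := f_monomial k; have [i [j ->]] := mdeg2P m2.
  by exists i, j; rewrite mpolyXD.
have f_mk k : tnth f k = 'X_[U_(a k) + U_(b k)] by rewrite mpolyXD.
have adj_conn := cohesive_connected f_ab f_canonical f_cohesive.
have ends_inj := ends_injective f_ab f_uniq.
have edgeE := graph_edgeE f_ab; have loopE := graph_loopE f_ab.
have cycE c := eq_graph_cycle c edgeE.
have incE : incidence_mx a b = \matrix_(i, k) ((U_(a k) + U_(b k))%MM i)%:Z.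
  rewrite -(log_matrixE f_ab); apply/matrixP=> i k.
  by rewrite !mxE f_mk mleadXm.
rewrite (log_matrixE f_ab).
set cycle_or_tree := _ \/ _.
have crem_det : cremona_set 2 f -> \det (incidence_mx a b) != 0.
  move/(cremona_setP f_monomial)=> f_rat.
  apply/negP=> /det0P[u /negP nz_u uA0]; case: nz_u; apply/eqP/rowP=> i.
  (* The weight of this square is twice [u 0 i], so it vanishes only if [u 0 i] does. *)
  have /f_rat : is_monomial 2 ('X_[U_(i) + U_(i)] : {mpoly K[n]}).
    by exists (U_(i) + U_(i))%MM; rewrite ?mdegD ?mdeg1.
  rewrite incE in uA0; move/(rational_in_weight f_mk uA0).
  rewrite (bigD1 i) //= big1 => [|j j'i]; last first.
    by rewrite mnmDE !mnm1E eq_sym (negPf j'i) mulr0.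
  by rewrite mnmDE !mnm1E eqxx mxE => ui0; lia.
have det_graph : \det (incidence_mx a b) != 0 -> cycle_or_tree.
  move=> nz_det.
  have lker0 (u : 'rV[int]_n) : u *m incidence_mx a b = 0 -> u = 0.
    move=> uA0; apply/eqP; apply: contraR nz_det => nz_u.
    by apply/det0P; exists u.
  have rker0 (c : 'cV[int]_n) : incidence_mx a b *m c = 0 -> c = 0.
    (* [det0P] concerns left kernels, hence the transposition. *)
    move=> Ac0; apply/eqP; rewrite -trmx_eq0; apply: contraR nz_det => nz_c.
    by rewrite -det_tr; apply/det0P; exists c^T; rewrite // -trmx_mul Ac0 trmx0.
  have [[i ii] | no_loop] := altP (existsP (P := fun i => adjacent a b i i)).
    right; split; last first.
      exists i; split=> [|j]; rewrite loopE // => jj.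
      exact: (loop_unique ends_inj adj_conn rker0 ii jj).
    split=> [x y | c /cycE]; last first.
      exact: (loop_no_cycle ends_inj adj_conn rker0 ii).
    (* Removing loops keeps the graph connected: a step from a vertex to itself can be skipped. *)
    apply: connect_sub (adj_conn x y) => u v uv.
    have [-> // | u'v] := eqVneq u v.
    by apply: connect1; rewrite edgeE /proper_adjacent u'v.
  have no_loops i : ~~ adjacent a b i i.
    by apply: contra no_loop => ii; apply/existsP; exists i.
  left; split=> [i|]; first by rewrite loopE.
  have i0 : 'I_n by apply: Ordinal (ltnW hn).
  have [p [x_p last_p odd_p]] := exists_odd_closed_walk adj_conn i0 lker0.
  (* [cycle] closes the walk by itself, so the final return to the base point is split off. *)
  case/lastP: p x_p last_p odd_p => // p x x_p last_p odd_p.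
  rewrite last_rcons in last_p; rewrite last_p size_rcons in x_p odd_p.
  have adj_irr : irreflexive (adjacent a b) by move=> i; apply: negbTE.
  have [c [c_cyc odd_c]] := odd_closed_walk_cycle adj_irr x_p odd_p.
  have {}c_cyc : graph_cycle (proper_adjacent a b) c.
    apply/(@eq_graph_cycle _ (adjacent a b)) => // u v.
    rewrite /proper_adjacent.
    by case: eqVneq => // ->; rewrite adj_irr.
  exists c; split=> // [|c' /cycE]; first exact/cycE.
  exact: proper_cycle_edges_unique.
have graph_crem : cycle_or_tree -> cremona_set 2 f.
  move=> f_graph.
  (* Either the odd cycle or the loop, as a walk of length one, is an odd closed walk. *)
  have [x [p [x_p last_p odd_p]]] : exists x p,
      [/\ path (adjacent a b) x p, last x p = x & odd (size p)].
    case: f_graph => [[_ [[|x p] [/cycE c_cyc _ odd_c]]] // | [_ [i [ii _]]]].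
      have [x_p last_p] := proper_cycle_walk c_cyc.
      by exists x, (rcons p x); rewrite size_rcons.
    by exists i, [:: i]; apply: loop_walk; rewrite -loopE.
  apply/(cremona_setP f_monomial) => _ [m m2 ->].
  have [i [j ->]] := mdeg2P m2.
  have [c def_c] :=
    odd_closed_walk_lattice ends_inj adj_conn x_p last_p odd_p i j.
  apply: (monomial_rational_in f_mk (c := c)); rewrite -incE def_c.
  apply/colP=> y; rewrite !mxE mnmDE !mnm1E !andbT PoszD !natz.
  by rewrite ![y == _]eq_sym.
by split; split; tauto.
Qed.
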